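(* Let $V=\mathbb C^{0|2}$ with $\omega=\begin{pmatrix}0&1\\-1&0\end{pmatrix}$, so $\mathfrak{osp}(V;\omega)=\mathfrak{sp}_2(\mathbb C)$ and $\mathrm{sdim}(V)=-2$. For any $\mathfrak{sp}_2$-module $M$, the functor $\mathcal F_M:\mathcal{PB}(-2)\to\mathcal T_M(V)$ factors through $\mathcal{PTL}(-2)$; that is, there exists a unique functor $\mathcal F^{TL}_M:\mathcal{PTL}(-2)\to\mathcal T_M(V)$ such that $\mathcal F_M$ is the composite of the quotient functor $\mathcal{PB}(-2)\to\mathcal{PTL}(-2)$ with $\mathcal F^{TL}_M$.
   Context: **Lie theory.** $V=\mathbb C^{0|2}$ is purely odd. For the matrix form $\omega$ on a basis $e^1,e^2$, $g^{ab}=\omega(e^a,e^b)$, $(g_{ab})=(g^{ab})^{-1}$, $\{e_a\}$ is the basis with $\omega(e_a,e^b)=\delta_a^b$, $E^a_b$ the matrix units $E^c_b(e^a)=\delta^a_be^c$, and $X^a_b\in\mathfrak g=\mathfrak{sp}_2$ is the element $E^a_b+\sum_{a',b'}g^{aa'}g_{bb'}E^{b'}_{a'}$ of $\mathrm{End}(V)$. The tempered Casimir is $t=-\frac12\sum_{a,b}X^a_b\otimes X^b_a\in\mathrm U(\mathfrak g)^{\otimes2}$. $\mu_M,\mu$ are the representations on $M,V$. $\tau:V\otimes V\to V\otimes V$ is $w\otimes w'\mapsto-w'\otimes w$; $\hat C(v\otimes v')=\omega(v,v')$; $\check C(1)=\sum_ae^a\otimes e_a$. $\mathcal T_M(V)$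 is the full subcategory of $\mathfrak{sp}_2$-modules with objects $M\otimes V^{\otimes r}$, $r\in\mathbb N$. **The category $\mathcal{MPB}(\delta)$.** Words are finite (possibly empty) sequences in the letters $m,v$; $v^r$ denotes $r$ copies of $v$. A coloured Brauer diagram from a word $s$ to a word $t$ is a perfect matching of the set of bottom points (one per letter of $s$, left to right) and top points (one per letter of $t$) such that matched points carry the same letter and two points in the same row are matched only if their letter is $v$. Let $\mathcal{C}$ be the $\mathbb C$-linear strict monoidal category with words as objects, these diagrams as a basis of $\mathrm{Hom}(s,t)$, composition $BA$ given by stacking $B$ on top of $A$ and replacing each closed loop by the factor $\delta$, and $\otimes$ given by concatenation/juxtaposition. Write $I(s)$ for identities, $\mathbb I=I(m)$, $I=I(v)$, $X_{a,b}:(a,b)\to(b,a)$ for the crossing, $X(s,t):(s,t)\to(t,s)$ for the crossing of two blocks of parallel strands, $X=X_{v,v}$, $\cup:\emptyset\to(v,v)$, $\cap:(v,v)\to\emptyset$, $E=\cup\cap$. The multi-polar Brauer category $\mathcal{MPB}(\delta)$ is the $\mathbb C$-linear strict monoidal category obtained from $\mathcal C$ by freely adjoining morphisms $\mathbb H(a,b):(a,b)\to(a,b)$, $a,b\in\{m,v\}$, subject to, for all letters $a,b,c$ and words $w$: (i) $X(w,(a,b))(I(w)\otimes\mathbb H(a,b))=(\mathbb H(a,b)\otimes I(w))X(w,(a,b))$ and $X((a,b),w)(\mathbb H(a,b)\otimes I(w))=(I(w)\otimes\mathbb H(a,b))X((a,b),w)$; (ii) $X_{b,a}\mathbb H(b,a)=\mathbb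 H(a,b)X_{b,a}$; (iii) $(I\otimes\cap\otimes I(a))(X\otimes\mathbb H(v,a))(I\otimes\cup\otimes I(a))=-\mathbb H(v,a)$ and $(I(a)\otimes\cap\otimes I)(\mathbb H(a,v)\otimes X)(I(a)\otimes\cup\otimes I)=-\mathbb H(a,v)$; (iv) with $\mathbb H_{12}=\mathbb H(a,b)\otimes I(c)$, $\mathbb H_{23}=I(a)\otimes\mathbb H(b,c)$, $\mathbb H_{13}=(I(a)\otimes X_{c,b})(\mathbb H(a,c)\otimes I(b))(I(a)\otimes X_{b,c})$, one has $[\mathbb H_{12},\mathbb H_{13}+\mathbb H_{23}]=0=[\mathbb H_{12}+\mathbb H_{13},\mathbb H_{23}]$; (v) $\mathbb H(v,v)=X-E$. $\mathcal{PB}(\delta)$ is the full subcategory with objects $(m,v^r)$, $r\in\mathbb N$. For $\delta\neq0$, $\mathcal{MTL}(\delta)=\mathcal{MPB}(\delta)/\langle\Theta\rangle$, where $\langle\Theta\rangle$ is the tensor ideal generated by $\Theta=X+I\otimes I-\frac2\delta E\in\mathrm{End}(v^2)$, and $\mathcal{PTL}(\delta)$ is the full subcategory of $\mathcal{MTL}(\delta)$ with objects $(m,v^r)$. **The functor $\mathcal F_M$.** For $\delta=-2$, there is a monoidal functor from $\mathcal{MPB}(-2)$ to (super) $\mathfrak{sp}_2$-modules with $m\mapsto M$, $v\mapsto V$, crossings $\mapsto$ graded flips, $\cup\mapsto\check C$, $\cap\mapsto\hat C$, $\mathbb H(a,b)\mapsto(\mu_A\otimes\mu_B)(t)$ where $A,B\in\{M,V\}$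 are the images of $a,b$; $\mathcal F_M$ is its restriction to $\mathcal{PB}(-2)$. *)

(* Defs.v *)
From HB Require Import structures.
From mathcomp Require Import all_boot all_order all_algebra.
From mathcomp Require Import boolp classical_sets functions.
From mathcomp Require Import reals complex.

Set Implicit Arguments.
Unset Strict Implicit.
Unset Printing Implicit Defensive.

Import GRing.Theory.
Local Open Scope ring_scope.
Local Open Scope quotient_scope.

(* A vector space presented by representatives: the laws hold up to [req]. *)
Record premod (K : fieldType) := Premod {
  raw : Type;
  req : raw -> raw -> Prop;
  rzero : raw;
  radd : raw -> raw -> raw;
  rscale : K -> raw -> raw;
  req_refl : forall x, req x x;
  req_sym : forall x y, req x y -> req y x;
  req_trans : forall y x z, req x y -> req y z -> req x z;
  req_add : forall x x' y y', req x x' -> req y y' ->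
    req (radd x y) (radd x' y');
  req_scale : forall k x x', req x x' -> req (rscale k x) (rscale k x');
  raddA : forall x y z, req (radd x (radd y z)) (radd (radd x y) z);
  raddC : forall x y, req (radd x y) (radd y x);
  radd0 : forall x, req (radd rzero x) x;
  rscaleA : forall k l x, req (rscale k (rscale l x)) (rscale (k * l) x);
  rscale1 : forall x, req (rscale 1 x) x;
  rscaleDr : forall k x y,
    req (rscale k (radd x y)) (radd (rscale k x) (rscale k y));
  rscaleDl : forall k l x,
    req (rscale (k + l) x) (radd (rscale k x) (rscale l x));
  rscale0 : forall x, req (rscale 0 x) rzero }.

Section QuotientModule.
Variables (K : fieldType) (T : premod K).

Definition rawT := raw T.
HB.instance Definition _ := gen_eqMixin rawT.
HB.instance Definition _ := gen_choiceMixin rawT.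

Definition reqb : rel rawT := fun x y => `[< req x y >].

Lemma reqb_equiv : equiv_class_of reqb.
Proof.
split=> [x|x y|y x z].
- by apply/asboolP/req_refl.
- by apply/asboolP/asboolP => /req_sym.
- by move=> /asboolP xy /asboolP yz; apply/asboolP/(req_trans xy yz).
Qed.
Canonical reqb_equiv_rel := EquivRelPack reqb_equiv.

Definition quo := {eq_quot reqb}.
HB.instance Definition _ := Choice.on quo.
HB.instance Definition _ := EqQuotient.on quo.

Definition cls (x : raw T) : quo := \pi_quo (x : rawT).
Definition rep (z : quo) : raw T := repr z.

Lemma clsP (x y : raw T) : cls x = cls y <-> req x y.
Proof. by split=> [/eqmodP /asboolP|xy]; last by apply/eqmodP/asboolP. Qed.

Lemma repK (z : quo) : cls (rep z) = z. Proof. exact: reprK. Qed.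

Lemma rep_cls (x : raw T) : req (rep (cls x)) x.
Proof. by apply/clsP; rewrite repK. Qed.

Definition qzero : quo := cls (@rzero _ T).
Definition qadd (x y : quo) : quo := cls (radd (rep x) (rep y)).
Definition qscale (k : K) (x : quo) : quo := cls (rscale k (rep x)).
Definition qopp (x : quo) : quo := qscale (-1) x.

Lemma cls_addE x y : cls (radd x y) = qadd (cls x) (cls y).
Proof. by apply/clsP/req_add; apply/req_sym/rep_cls. Qed.

Lemma cls_scaleE k x : cls (rscale k x) = qscale k (cls x).
Proof. by apply/clsP/req_scale/req_sym/rep_cls. Qed.

Lemma cls_ind (P : quo -> Prop) : (forall x, P (cls x)) -> forall z, P z.
Proof. by move=> Pc z; rewrite -(repK z). Qed.

Lemma qaddA : associative qadd.
Proof.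
elim/cls_ind=> x; elim/cls_ind=> y; elim/cls_ind=> z.
by rewrite -!cls_addE; apply/clsP/raddA.
Qed.

Lemma qaddC : commutative qadd.
Proof.
by elim/cls_ind=> x; elim/cls_ind=> y; rewrite -!cls_addE; apply/clsP/raddC.
Qed.

Lemma qadd0 : left_id qzero qadd.
Proof. by elim/cls_ind=> x; rewrite -cls_addE; apply/clsP/radd0. Qed.

Lemma qscale1 : left_id 1 qscale.
Proof. by elim/cls_ind=> x; rewrite -cls_scaleE; apply/clsP/rscale1. Qed.

Lemma qscaleDl z : {morph qscale^~ z : k l / k + l >-> qadd k l}.
Proof.
elim/cls_ind: z => x k l.
by rewrite -!cls_scaleE -cls_addE; apply/clsP/rscaleDl.
Qed.

Lemma qscale0 z : qscale 0 z = qzero.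
Proof. by elim/cls_ind: z => x; rewrite -cls_scaleE; apply/clsP/rscale0. Qed.

Lemma qaddN : left_inverse qzero qopp qadd.
Proof.
by move=> z; rewrite -{2}(qscale1 z) -qscaleDl addNr qscale0.
Qed.

HB.instance Definition _ :=
  GRing.isZmodule.Build quo qaddA qaddC qadd0 qaddN.

Lemma qscaleA k l z : qscale k (qscale l z) = qscale (k * l) z.
Proof.
by elim/cls_ind: z => x; rewrite -!cls_scaleE; apply/clsP/rscaleA.
Qed.

Lemma qscaleDr : right_distributive qscale +%R.
Proof.
move=> k; elim/cls_ind=> x; elim/cls_ind=> y.
by rewrite -[_ + _]cls_addE -!cls_scaleE -[_ + _]cls_addE; apply/clsP/rscaleDr.
Qed.

HB.instance Definition _ := GRing.Zmodule_isLmodule.Build K quo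
  qscaleA qscale1 qscaleDr qscaleDl.

Lemma clsD x y : cls (radd x y) = cls x + cls y. Proof. exact: cls_addE. Qed.
Lemma clsZ k x : cls (rscale k x) = k *: cls x. Proof. exact: cls_scaleE. Qed.
Lemma cls0 : cls (@rzero _ T) = 0. Proof. by []. Qed.

End QuotientModule.

Definition lin_pack (K : fieldType) (U P : lmodType K) (f : U -> P)
    (lf : linear f) : {linear U -> P} :=
  let g := GRing.isLinear.Build _ _ _ _ _ lf in HB.pack f g.

Definition bilin (K : fieldType) (M N P : lmodType K) (f : M -> N -> P) :=
  (forall x, linear (f x)) /\ (forall y, linear (f^~ y)).

Section Tensor.
Variables (K : fieldType) (M N : lmodType K).

(* A sequence of pairs stands for the sum of the corresponding pure tensors;
   two sums are identified when no bilinear map distinguishes them. *)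
Definition tsum (P : lmodType K) (f : M -> N -> P) (s : seq (M * N)) : P :=
  \sum_(p <- s) f p.1 p.2.

Definition teq (s t : seq (M * N)) : Prop :=
  forall (P : lmodType K) (f : M -> N -> P), bilin f -> tsum f s = tsum f t.

Definition tscale (k : K) (s : seq (M * N)) := [seq (k *: p.1, p.2) | p <- s].

Lemma tsum_scale (P : lmodType K) (f : M -> N -> P) k s : bilin f ->
  tsum f (tscale k s) = k *: tsum f s.
Proof.
move=> -[_ fl]; rewrite /tsum big_map scaler_sumr; apply: eq_bigr => p _ /=.
exact: (linearZ_LR (lin_pack (fl p.2))).
Qed.

Program Definition tensor_premod : premod K :=
  @Premod K (seq (M * N)) teq [::] cat tscale
    _ _ _ _ _ _ _ _ _ _ _ _ _.
Next Obligation. by []. Qed.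
Next Obligation. by move=> P f bf; rewrite H. Qed.
Next Obligation. by move=> P f bf; rewrite H // H0. Qed.
Next Obligation.
move=> P f bf; rewrite /tsum !big_cat; congr (_ + _); [exact: H|exact: H0].
Qed.
Next Obligation. by move=> P f bf; rewrite !tsum_scale // H. Qed.
Next Obligation. by move=> P f bf; rewrite catA. Qed.
Next Obligation. by move=> P f bf; rewrite /tsum !big_cat /= addrC. Qed.
Next Obligation. by []. Qed.
Next Obligation. by move=> P f bf; rewrite !tsum_scale // scalerA. Qed.
Next Obligation. by move=> P f bf; rewrite tsum_scale // scale1r. Qed.
Next Obligation. by move=> P f bf; rewrite /tscale map_cat. Qed.
Next Obligation.
move=> P f bf; rewrite tsum_scale // scalerDl -!tsum_scale //.
by rewrite /tsum big_cat.
Qed.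
Next Obligation.
by move=> P f bf; rewrite tsum_scale // scale0r /tsum big_nil.
Qed.

Definition tensor : lmodType K := quo tensor_premod.

Definition pure (x : M) (y : N) : tensor := @cls _ tensor_premod [:: (x, y)].

(* The induced linear map when [f] is bilinear; meaningless otherwise. *)
Definition tlift (P : lmodType K) (f : M -> N -> P) (z : tensor) : P :=
  tsum f (@rep _ tensor_premod z).

Lemma pure_sum (s : seq (M * N)) :
  @cls _ tensor_premod s = \sum_(p <- s) pure p.1 p.2.
Proof.
elim: s => [|[x y] s IH]; first by rewrite big_nil.
by rewrite big_cons -IH /= -clsD.
Qed.

Lemma tensorE (z : tensor) :
  z = \sum_(p <- @rep _ tensor_premod z) pure p.1 p.2.
Proof. by rewrite -pure_sum repK. Qed.

Lemma pure_bilin : bilin pure.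
Proof.
split=> [x k y y'|y k x x']; rewrite /pure -clsZ -clsD; apply/clsP;
  move=> P f [fr fl]; rewrite /tsum !big_cons !big_nil !addr0 /=.
- rewrite fr; congr (_ + _).
  exact: esym (linearZ_LR (lin_pack (fl y)) _ _).
- rewrite fl; congr (_ + _).
  exact: esym (linearZ_LR (lin_pack (fl y)) _ _).
Qed.

Lemma tlift_pure (P : lmodType K) (f : M -> N -> P) x y : bilin f ->
  tlift f (pure x y) = f x y.
Proof.
move=> bf; rewrite /tlift (@rep_cls _ tensor_premod _ _ f bf).
by rewrite /tsum big_cons big_nil addr0.
Qed.

Lemma tlift_linear (P : lmodType K) (f : M -> N -> P) : bilin f -> linear (tlift f).
Proof.
move=> bf k z w; rewrite -(repK z) -(repK w) -clsZ -clsD /tlift.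
rewrite !(@rep_cls _ tensor_premod _ _ f bf).
by rewrite [LHS]big_cat /= -[X in X + _]/(tsum f (tscale k _)) tsum_scale.
Qed.

Lemma tensor_ext (P : lmodType K) (f g : tensor -> P) :
  linear f -> linear g -> (forall x y, f (pure x y) = g (pure x y)) ->
  forall z, f z = g z.
Proof.
move=> lf lg fg z.
rewrite -[f z]/(lin_pack lf z) -[g z]/(lin_pack lg z) (tensorE z) !linear_sum.
by apply: eq_bigr => p _; exact: fg.
Qed.

End Tensor.

Section Sp2.
Variable K : fieldType.

Definition gup : 'M[K]_2 := \matrix_(a, b) ((a < b)%N%:R - (b < a)%N%:R).
Definition glow : 'M[K]_2 := invmx gup.

Definition omega (x y : 'cV[K]_2) : K := (x^T *m gup *m y) 0 0.

Definition eup (a : 'I_2) : 'cV[K]_2 := delta_mx a 0.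
Definition elow (a : 'I_2) : 'cV[K]_2 := \sum_b glow a b *: eup b.

Lemma omega_eup a b : omega (eup a) (eup b) = gup a b.
Proof. by rewrite /omega /eup trmx_delta -rowE -colE !mxE. Qed.

Lemma gup_sqr : gup *m gup = - 1%:M.
Proof.
apply/matrixP=> a b; rewrite !mxE !big_ord_recl big_ord0 !mxE.
by case: a b => [[|[|//]] ?] [[|[|//]] ?] /=;
  rewrite ?(mulr0, mul0r, subr0, sub0r, addr0, add0r, mulrN, mulNr, mulr1, subrr, oppr0).
Qed.

Lemma glowE : glow = - gup.
Proof.
have h : gup *m (- gup) = 1%:M by rewrite mulmxN gup_sqr opprK.
have u : gup \in unitmx by case/mulmx1_unit: h.
by rewrite /glow -[RHS](mulKmx u) h mulmx1.
Qed.

Lemma omega_elow a b : omega (elow a) (eup b) = (a == b)%:R.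
Proof.
have -> : elow a = (row a glow)^T.
  by rewrite [row _ _]row_sum_delta linear_sum; apply: eq_bigr => c _;
     rewrite linearZ /= trmx_delta mxE.
have u : gup \in unitmx.
  by case: (@mulmx1_unit _ _ gup (- gup)); rewrite ?mulmxN ?gup_sqr ?opprK.
by rewrite /omega trmxK /eup -row_mul mulVmx // -colE !mxE.
Qed.

Definition sp2_pred : {pred 'M[K]_2} :=
  fun A => A^T *m gup + gup *m A == 0.

Lemma sp2_submod : submod_closed sp2_pred.
Proof.
split=> [|k A B]; rewrite !unfold_in ?trmx0 ?mul0mx ?mulmx0 ?addr0 //.
move=> /eqP hA /eqP hB; apply/eqP.
rewrite linearP /= mulmxDl mulmxDr -scalemxAl -scalemxAr addrACA -scalerDr.
by rewrite hA hB scaler0 addr0.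
Qed.
HB.instance Definition _ :=
  GRing.isSubmodClosed.Build K 'M[K]_2 sp2_pred sp2_submod.

Record sp2 := Sp2 { sp2mx :> 'M[K]_2; _ : sp2mx \in sp2_pred }.
HB.instance Definition _ := [isSub of sp2 for sp2mx].
HB.instance Definition _ := [Choice of sp2 by <:].
HB.instance Definition _ := [SubChoice_isSubZmodule of sp2 by <:].
HB.instance Definition _ := [SubZmodule_isSubLmodule of sp2 by <:].

Lemma sp2_bracketP (A B : sp2) : A *m B - B *m A \in sp2_pred.
Proof.
case: A B => [A hA] [B hB]; rewrite /= !unfold_in in hA hB *.
move/eqP/(canRL (addrK _)): hA; rewrite sub0r => hA.
move/eqP/(canRL (addrK _)): hB; rewrite sub0r => hB.
rewrite linearB /= !trmx_mul mulmxBl mulmxBr -!mulmxA hA hB.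
rewrite !mulmxN !mulmxA hA hB !mulNmx !opprK.
by rewrite addrC subrKA subrr.
Qed.
Definition sp2_bracket (A B : sp2) : sp2 := Sp2 (sp2_bracketP A B).

(* [delta_mx c b] is the matrix unit E^c_b. *)
Definition Xmat (a b : 'I_2) : 'M[K]_2 :=
  delta_mx a b + \sum_a' \sum_b' (gup a a' * glow b b') *: delta_mx b' a'.

Lemma XmatP a b : Xmat a b \in sp2_pred.
Proof.
rewrite unfold_in /Xmat glowE !big_ord_recl !big_ord0.
apply/eqP/matrixP=> i j.
rewrite !mxE !big_ord_recl !big_ord0 !mxE.
by case: a b i j => [[|[|//]] ?] [[|[|//]] ?] [[|[|//]] ?] [[|[|//]] ?] /=;
  rewrite ?(mulr0, mul0r, subr0, sub0r, addr0, add0r, mulrN, mulNr, mulr1, mul1r, subrr, oppr0, opprK, addNr).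
Qed.
Definition Xel (a b : 'I_2) : sp2 := Sp2 (XmatP a b).

End Sp2.

(* A super sp_2-module; [sproj b] is the projection onto the homogeneous part
   of degree [b] (even for [false], odd for [true]). As sp_2 is purely even, it
   acts by even operators. *)
Record smod (K : fieldType) := Smod {
  scar :> lmodType K;
  sproj : bool -> scar -> scar;
  sact : sp2 K -> scar -> scar;
  sproj_lin : forall b, linear (sproj b);
  sprojK : forall b c x, sproj b (sproj c x) = if b == c then sproj c x else 0;
  sproj_sum : forall x, sproj false x + sproj true x = x;
  sact_linr : forall A, linear (sact A);
  sact_linl : forall x, linear (sact^~ x);
  sact_bracket : forall A B x,
    sact (sp2_bracket A B) x = sact A (sact B x) - sact B (sact A x);
  sact_even : forall A b x, sact A (sproj b x) = sproj b (sact A x) }.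

Definition homog (K : fieldType) (M : smod K) (b : bool) (x : M) : Prop :=
  sproj b x = x.

Section Modules.
Variable K : fieldType.

Program Definition smod_unit : smod K :=
  @Smod K K^o (fun b x => if b then 0 else x) (fun _ _ => 0) _ _ _ _ _ _ _.
Next Obligation. by move=> k x y; case: b; rewrite ?scaler0 ?addr0. Qed.
Next Obligation. by case: b c => [] []. Qed.
Next Obligation. by rewrite addr0. Qed.
Next Obligation. by move=> k x y; rewrite scaler0 addr0. Qed.
Next Obligation. by move=> k A B; rewrite scaler0 addr0. Qed.
Next Obligation. by rewrite subr0. Qed.
Next Obligation. by case: b. Qed.

(* C^{0|2}: column vectors, all of them odd. *)
Program Definition smodV : smod K :=
  @Smod K 'cV[K]_2 (fun b x => if b then x else 0) (fun A x => sp2mx A *m x)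
    _ _ _ _ _ _ _.
Next Obligation. by move=> k x y; case: b; rewrite ?scaler0 ?addr0. Qed.
Next Obligation. by case: b c => [] []. Qed.
Next Obligation. by rewrite add0r. Qed.
Next Obligation. by move=> k x y; rewrite mulmxDr -scalemxAr. Qed.
Next Obligation. by move=> k A B; rewrite mulmxDl -scalemxAl. Qed.
Next Obligation. by rewrite mulmxBl !mulmxA. Qed.
Next Obligation. by case: b; rewrite ?mulmx0. Qed.

Section TensorModule.
Variables M N : smod K.

Definition tproj (b : bool) : tensor M N -> tensor M N :=
  tlift (fun x y => pure (sproj false x) (sproj b y)
                    + pure (sproj true x) (sproj (~~ b) y)).
Definition tact (A : sp2 K) : tensor M N -> tensor M N :=
  tlift (fun x y => pure (sact A x) y + pure x (sact A y)).

Lemma bilinD (P : lmodType K) (f g : M -> N -> P) :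
  bilin f -> bilin g -> bilin (fun x y => f x y + g x y).
Proof.
move=> [fr fl] [gr gl]; split=> [x k y y'|y k x x'] /=.
- by rewrite fr gr addrACA -scalerDr.
- by rewrite fl gl addrACA -scalerDr.
Qed.

Lemma bilin_comp (M' N' : lmodType K) (f : M -> M') (g : N -> N') :
  linear f -> linear g -> bilin (fun x y => pure (f x) (g y)).
Proof.
have [pr pl] := pure_bilin M' N'.
move=> lf lg; split=> [x k y y'|y k x x'] /=; first by rewrite lg pr.
by rewrite lf -pl.
Qed.

Lemma id_linear (U : lmodType K) : linear (@id U). Proof. by []. Qed.

Lemma tproj_bilin b : bilin (fun x y =>
  pure (@sproj _ M false x) (@sproj _ N b y)
  + pure (@sproj _ M true x) (@sproj _ N (~~ b) y)).
Proof. by apply: bilinD; apply: bilin_comp; exact: sproj_lin. Qed.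

Lemma tact_bilin A : bilin (fun x y =>
  pure (@sact _ M A x) y + pure x (@sact _ N A y)).
Proof.
by apply: bilinD; apply: bilin_comp; try exact: sact_linr; exact: id_linear.
Qed.

Lemma tproj_lin b : linear (tproj b).
Proof. exact/tlift_linear/tproj_bilin. Qed.
Lemma tact_linr A : linear (tact A).
Proof. exact/tlift_linear/tact_bilin. Qed.

Lemma tprojE b x y : tproj b (pure x y) =
  pure (sproj false x) (sproj b y) + pure (sproj true x) (sproj (~~ b) y).
Proof. exact/tlift_pure/tproj_bilin. Qed.
Lemma tactE A x y : tact A (pure x y) = pure (sact A x) y + pure x (sact A y).
Proof. exact/tlift_pure/tact_bilin. Qed.

Lemma linD (U P : lmodType K) (f : U -> P) : linear f -> {morph f : x y / x + y}.
Proof. by move=> lf x y; exact: (linearD (lin_pack lf)). Qed.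
Lemma lin0 (U P : lmodType K) (f : U -> P) : linear f -> f 0 = 0.
Proof. by move=> lf; exact: (linear0 (lin_pack lf)). Qed.
Lemma lin_comp (U P Q : lmodType K) (f : U -> P) (g : P -> Q) :
  linear f -> linear g -> linear (fun x => g (f x)).
Proof. by move=> lf lg k x y; rewrite lf lg. Qed.
Lemma lin_add (U P : lmodType K) (f g : U -> P) :
  linear f -> linear g -> linear (fun x => f x + g x).
Proof. by move=> lf lg k x y; rewrite lf lg addrACA -scalerDr. Qed.
Lemma lin_scale (U P : lmodType K) (f : U -> P) (c : K) :
  linear f -> linear (fun x => c *: f x).
Proof.
by move=> lf k x y; rewrite lf scalerDr !scalerA mulrC.
Qed.
Lemma lin_zero (U P : lmodType K) : linear (fun _ : U => 0 : P).
Proof. by move=> k x y; rewrite scaler0 addr0. Qed.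

Lemma pure0r (x : M) : pure x (0 : N) = 0.
Proof. exact: (lin0 ((pure_bilin M N).1 x)). Qed.
Lemma pure0l (y : N) : pure (0 : M) y = 0.
Proof. exact: (lin0 ((pure_bilin M N).2 y)). Qed.
Lemma pureDr (x : M) (y y' : N) : pure x (y + y') = pure x y + pure x y'.
Proof. exact: (linD ((pure_bilin M N).1 x)). Qed.
Lemma pureDl (x x' : M) (y : N) : pure (x + x') y = pure x y + pure x' y.
Proof. exact: (linD ((pure_bilin M N).2 y)). Qed.
Lemma pureZr k (x : M) (y : N) : pure x (k *: y) = k *: pure x y.
Proof. exact: (linearZ_LR (lin_pack ((pure_bilin M N).1 x))). Qed.
Lemma pureZl k (x : M) (y : N) : pure (k *: x) y = k *: pure x y.
Proof. exact: (linearZ_LR (lin_pack ((pure_bilin M N).2 y))). Qed.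

Lemma tprojK b c z : tproj b (tproj c z) = if b == c then tproj c z else 0.
Proof.
move: z; apply: tensor_ext => [||x y].
- by apply: lin_comp; exact: tproj_lin.
- by case: eqP => _; [exact: tproj_lin|exact: lin_zero].
rewrite [tproj c _]tprojE (linD (@tproj_lin b)) !tprojE !sprojK.
by case: b c => [] [] /=; rewrite !(pure0r, pure0l, addr0, add0r).
Qed.

Lemma tproj_sum z : tproj false z + tproj true z = z.
Proof.
move: z; apply: tensor_ext => [||x y].
- by apply: lin_add; exact: tproj_lin.
- exact: id_linear.
rewrite !tprojE /= addrACA -!pureDr sproj_sum.
by rewrite [sproj true y + _]addrC sproj_sum -pureDl sproj_sum.
Qed.

Lemma tact_linl z : linear (tact^~ z).
Proof.
move=> k A B; move: z; apply: tensor_ext => [||x y].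
- exact: tact_linr.
- by apply: lin_add; [apply: lin_scale|]; exact: tact_linr.
rewrite !tactE (sact_linl x) (sact_linl y) pureDl pureDr pureZl pureZr.
by rewrite addrACA -scalerDr.
Qed.

Lemma tact_bracket A B z :
  tact (sp2_bracket A B) z = tact A (tact B z) - tact B (tact A z).
Proof.
rewrite -scaleN1r addrC; move: z; apply: tensor_ext => [||x y].
- exact: tact_linr.
- by apply: lin_add; [apply: lin_scale|]; apply: lin_comp; exact: tact_linr.
rewrite !tactE (linD (tact_linr A)) (linD (tact_linr B)) !tactE !sact_bracket.
rewrite pureDl pureDr -!scaleN1r pureZl pureZr !scalerDr.
set a := pure (sact A (sact B x)) y; set b := pure x (sact A (sact B y)).
set c := pure (sact B (sact A x)) y; set d := pure x (sact B (sact A y)).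
set e := pure (sact A x) (sact B y); set f := pure (sact B x) (sact A y).
rewrite !scaleN1r.
rewrite [X in _ = _ + X]addrACA [RHS]addrACA.
rewrite [X in _ = X + _]addrACA [X in _ = _ + X]addrACA !addNr addr0 add0r.
by rewrite [a - c]addrC [b - d]addrC.
Qed.

Lemma tact_even A b z : tact A (tproj b z) = tproj b (tact A z).
Proof.
move: z; apply: tensor_ext => [||x y].
- by apply: lin_comp; [exact: tproj_lin|exact: tact_linr].
- by apply: lin_comp; [exact: tact_linr|exact: tproj_lin].
rewrite tprojE tactE (linD (@tact_linr A)) (linD (@tproj_lin b)) !tactE !tprojE.
by rewrite !sact_even addrACA.
Qed.

Definition smod_tensor : smod K := Smod
  tproj_lin tprojK tproj_sum tact_linr tact_linl tact_bracket tact_even.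

End TensorModule.

(* Parity-preserving sp_2-linear maps. *)
Definition is_smod_hom (M N : smod K) (f : M -> N) : Prop :=
  [/\ linear f, forall b x, f (sproj b x) = sproj b (f x)
    & forall A x, f (sact A x) = sact A (f x)].

Definition smod_hom_pred (M N : smod K) : {pred M -> N} :=
  fun f => `[< is_smod_hom f >].

Lemma smod_hom_submod M N : submod_closed (@smod_hom_pred M N).
Proof.
split=> [|k f g]; rewrite !unfold_in.
  apply/asboolP; split=> [|b x|A x].
  - exact: lin_zero.
  - by rewrite (lin0 (@sproj_lin _ N b)).
  - by rewrite (lin0 (@sact_linr _ N A)).
move=> /asboolP [f1 f2 f3] /asboolP [g1 g2 g3]; apply/asboolP; split=> [|b x|A x].
- by apply: lin_add => //; exact: lin_scale.
- by rewrite sproj_lin -f2 -g2.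
- by rewrite sact_linr -f3 -g3.
Qed.
HB.instance Definition _ (M N : smod K) := GRing.isSubmodClosed.Build K (M -> N)
  (@smod_hom_pred M N) (@smod_hom_submod M N).

Record smod_hom (M N : smod K) :=
  SmodHom { smod_fun :> M -> N; _ : smod_fun \in @smod_hom_pred M N }.
HB.instance Definition _ (M N : smod K) := [isSub of smod_hom M N for @smod_fun M N].
HB.instance Definition _ (M N : smod K) := [Choice of smod_hom M N by <:].
HB.instance Definition _ (M N : smod K) := [SubChoice_isSubZmodule of smod_hom M N by <:].
HB.instance Definition _ (M N : smod K) := [SubZmodule_isSubLmodule of smod_hom M N by <:].

End Modules.

Record lincat (K : fieldType) := Lincat {
  obj :> Type;
  hom : obj -> obj -> lmodType K;
  idm : forall x, hom x x;
  comp : forall x y z, hom y z -> hom x y -> hom x z;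
  compA : forall x y z t (h : hom z t) (g : hom y z) (f : hom x y),
    comp h (comp g f) = comp (comp h g) f;
  comp1m : forall x y (f : hom x y), comp (idm y) f = f;
  compm1 : forall x y (f : hom x y), comp f (idm x) = f;
  comp_linr : forall x y z (g : hom y z), linear (@comp x y z g);
  comp_linl : forall x y z (f : hom x y), linear (fun g => @comp x y z g f) }.
Arguments hom {K l}.
Arguments idm {K l}.

(* Functors with prescribed object map [o]; no linearity is required. *)
Record functor_on (K : fieldType) (C D : lincat K) (o : C -> D) := FunctorOn {
  fmap : forall x y, hom x y -> hom (o x) (o y);
  fmap_id : forall x, fmap (idm x) = idm (o x);
  fmap_comp : forall x y z (g : hom y z) (f : hom x y),
    fmap (comp g f) = comp (fmap g) (fmap f) }.
Arguments fmap {K C D o} _ [x y].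

Record functor (K : fieldType) (C D : lincat K) :=
  Functor { fobj : C -> D; fmor :> functor_on fobj }.

Definition linear_functor (K : fieldType) (C D : lincat K) (o : C -> D)
    (F : functor_on o) : Prop :=
  forall x y : C, linear (@fmap _ _ _ _ F x y).

Program Definition functor_comp (K : fieldType) (C D E : lincat K)
    (G : functor D E) (F : functor C D) : functor C E :=
  Functor (@FunctorOn _ C E (fun x => fobj G (fobj F x))
             (fun x y f => fmap G (fmap F f)) _ _).
Next Obligation. by rewrite !fmap_id. Qed.
Next Obligation. by rewrite !fmap_comp. Qed.

(* The full subcategory on a family of objects, with the indices as objects. *)
Definition full_sub (K : fieldType) (C : lincat K) (I : Type) (o : I -> C) :
  lincat K :=
  @Lincat K I (fun i j => hom (o i) (o j)) (fun i => idm (o i))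
    (fun i j k g f => comp g f)
    (fun i j k l h g f => compA h g f)
    (fun i j f => comp1m f) (fun i j f => compm1 f)
    (fun i j k g => @comp_linr _ _ _ _ _ g)
    (fun i j k f => @comp_linl _ _ _ _ _ f).

Definition restrict (K : fieldType) (C D : lincat K) (o : C -> D)
    (F : functor_on o) (I : Type) (c : I -> C) :
  functor (full_sub c) (full_sub (fun i => o (c i))) :=
  @Functor _ (full_sub c) (full_sub (fun i => o (c i))) id
    (@FunctorOn _ (full_sub c) (full_sub (fun i => o (c i))) id
       (fun i j f => fmap F f) (fun i => fmap_id F (c i))
       (fun i j k g f => fmap_comp F g f)).

Section SmodCat.
Variable K : fieldType.

Lemma smod_homP (M N : smod K) (f : smod_hom M N) : is_smod_hom f.
Proof. by case: f => f /= /asboolP. Qed.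

Lemma smod_hom_ext (M N : smod K) (f g : smod_hom M N) : f =1 g -> f = g.
Proof. by move=> fg; apply/val_inj/funext. Qed.

Lemma smod_id_subproof (M : smod K) : id \in @smod_hom_pred K M M.
Proof. exact/asboolP. Qed.
Definition smod_id M : smod_hom M M := SmodHom (smod_id_subproof M).

Lemma smod_comp_subproof (M N P : smod K) (g : smod_hom N P)
    (f : smod_hom M N) : (fun x => g (f x)) \in @smod_hom_pred K M P.
Proof.
have [f1 f2 f3] := smod_homP f; have [g1 g2 g3] := smod_homP g.
apply/asboolP; split=> [|b x|A x]; first exact: lin_comp.
- by rewrite f2 g2.
- by rewrite f3 g3.
Qed.
Definition smod_comp (M N P : smod K) (g : smod_hom N P) (f : smod_hom M N) :
  smod_hom M P := SmodHom (smod_comp_subproof g f).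

Program Definition smod_cat : lincat K :=
  @Lincat K (smod K) (@smod_hom K) smod_id smod_comp _ _ _ _ _.
Next Obligation. exact: smod_hom_ext. Qed.
Next Obligation. exact: smod_hom_ext. Qed.
Next Obligation. exact: smod_hom_ext. Qed.
Next Obligation.
move=> k f f'; apply: smod_hom_ext => u /=.
by case: (smod_homP g) => gl _ _; exact: gl.
Qed.
Next Obligation. by move=> k g g'; exact: smod_hom_ext. Qed.

End SmodCat.

Inductive letter := Lm | Lv.
Definition bool_of_letter (a : letter) := if a is Lm then true else false.
Definition letter_of_bool b := if b is true then Lm else Lv.
Lemma bool_of_letterK : cancel bool_of_letter letter_of_bool.
Proof. by case. Qed.
HB.instance Definition _ := Equality.copy letter (can_type bool_of_letterK).

Notation word := (seq letter).

(* The points of a diagram: [inl] is the bottom row, [inr] the top row. *)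
Notation pt s t := ('I_(@size letter s) + 'I_(@size letter t))%type.

Section Diagrams.
Implicit Types s t u : word.

Definition colour s t (x : pt s t) : letter :=
  match x with inl i => nth Lm s i | inr j => nth Lm t j end.

Definition same_row s t (x y : pt s t) : bool :=
  match x, y with inl _, inl _ | inr _, inr _ => true | _, _ => false end.

(* A perfect matching is a fixed-point-free involution. *)
Definition is_diagram s t (p : {ffun pt s t -> pt s t}) : bool :=
  [forall x, [&& p (p x) == x, p x != x, colour (p x) == colour x
               & same_row x (p x) ==> (colour x == Lv)]].

Record diagram s t :=
  Diagram { mate :> {ffun pt s t -> pt s t}; mateP : is_diagram mate }.

Definition perm_mate s t (f : 'I_(size s) -> 'I_(size t))
    (g : 'I_(size t) -> 'I_(size s)) : {ffun pt s t -> pt s t} :=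
  [ffun x => match x with inl i => inr (f i) | inr j => inl (g j) end].

Lemma perm_mateP s t (f : 'I_(size s) -> 'I_(size t))
    (g : 'I_(size t) -> 'I_(size s)) :
  cancel f g -> cancel g f -> (forall i, nth Lm t (f i) = nth Lm s i) ->
  is_diagram (perm_mate f g).
Proof.
move=> fK gK fc; apply/forallP=> -[i|j]; rewrite !ffunE /=.
- by rewrite fK fc !eqxx.
- by rewrite gK -(fc (g j)) gK !eqxx.
Qed.

Definition idd s : diagram s s :=
  Diagram (@perm_mateP s s id id (fun=> erefl) (fun=> erefl) (fun=> erefl)).


Definition swapn s t (i : nat) : nat :=
  if (i < size s)%N then (size t + i)%N else (i - size s)%N.

Lemma swap_subproof s t (i : 'I_(size (s ++ t))) :
  (swapn s t i < size (t ++ s))%N.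
Proof.
have hi : (i < size s + size t)%N by rewrite -size_cat.
rewrite /swapn [X in (_ < X)%N]size_cat; case: (ltnP i (size s)) => h; first by rewrite ltn_add2l.
by rewrite ltn_subLR // (leq_trans hi) // addnA leq_addr.
Qed.
Definition swap s t (i : 'I_(size (s ++ t))) : 'I_(size (t ++ s)) :=
  Ordinal (swap_subproof i).

Lemma swapK s t : cancel (@swap s t) (@swap t s).
Proof.
move=> i; apply: val_inj => /=.
have hi : (i < size s + size t)%N by rewrite -size_cat.
rewrite /swapn.
case: (ltnP i (size s)) => h; first by rewrite ltnNge leq_addr /= addKn.
by rewrite ltn_subLR // hi subnKC.
Qed.

Lemma swap_colour s t i : nth Lm (t ++ s) (@swap s t i) = nth Lm (s ++ t) i.
Proof.
have hi : (i < size s + size t)%N by rewrite -size_cat.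
rewrite !nth_cat /= /swapn.
case: (ltnP i (size s)) => h; first by rewrite ltnNge leq_addr /= addKn.
by rewrite ltn_subLR // hi.
Qed.

Definition crossd s t : diagram (s ++ t) (t ++ s) :=
  Diagram (perm_mateP (@swapK s t) (@swapK t s) (@swap_colour s t)).

Definition cup_mate : {ffun pt [::] [:: Lv; Lv] -> pt [::] [:: Lv; Lv]} :=
  [ffun x => match x with inl i => inl i | inr j => inr (rev_ord j) end].
Lemma cup_mateP : is_diagram cup_mate.
Proof.
apply/forallP=> -[[]//|j]; rewrite !ffunE /= rev_ordK eqxx.
by case: j => [[|[|//]] ?].
Qed.
Definition cupd : diagram [::] [:: Lv; Lv] := Diagram cup_mateP.

Definition cap_mate : {ffun pt [:: Lv; Lv] [::] -> pt [:: Lv; Lv] [::]} :=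
  [ffun x => match x with inl i => inl (rev_ord i) | inr j => inr j end].
Lemma cap_mateP : is_diagram cap_mate.
Proof.
apply/forallP=> -[i|[]//]; rewrite !ffunE /= rev_ordK eqxx.
by case: i => [[|[|//]] ?].
Qed.
Definition capd : diagram [:: Lv; Lv] [::] := Diagram cap_mateP.

Section Stacking.
Variables (s t u : word) (d : diagram s t) (e : diagram t u).

(* [d] is stacked below [e]; [node] is the set of points of the stack, the
   middle row being shared. *)
Definition node : finType := (pt s t + 'I_(size u))%type.
Definition lower (x : pt s t) : node := inl x.
Definition upper (x : pt t u) : node :=
  match x with inl j => inl (inr j) | inr k => inr k end.
Definition outer (x : pt s u) : node :=
  match x with inl i => inl (inl i) | inr k => inr k end.

Definition strand : rel node := fun x y =>
  [exists p, (x == lower p) && (y == lower (d p))]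
  || [exists q, (x == upper q) && (y == upper (e q))].

Definition is_stack (c : diagram s u) : Prop := forall p q,
  (c p == q) = (p != q) && connect strand (outer p) (outer q).

(* The closed loops are the components without end points. *)
Definition loops : nat :=
  n_comp strand [pred x | [forall p, ~~ connect strand x (outer p)]].
End Stacking.

Section Juxtaposition.
Variables (s t s' t' : word).

Definition ordL (r r' : word) (i : 'I_(size r)) : 'I_(size (r ++ r')) :=
  cast_ord (esym (size_cat r r')) (lshift (size r') i).
Definition ordR (r r' : word) (i : 'I_(size r')) : 'I_(size (r ++ r')) :=
  cast_ord (esym (size_cat r r')) (rshift (size r) i).

Definition ptL (x : pt s t) : pt (s ++ s') (t ++ t') :=
  match x with inl i => inl (ordL s' i) | inr j => inr (ordL t' j) end.
Definition ptR (x : pt s' t') : pt (s ++ s') (t ++ t') :=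
  match x with inl i => inl (ordR s i) | inr j => inr (ordR t j) end.

Definition is_juxt (d : diagram s t) (d' : diagram s' t')
    (c : diagram (s ++ s') (t ++ t')) : Prop :=
  (forall x, c (ptL x) = ptL (d x)) /\ (forall y, c (ptR y) = ptR (d' y)).
End Juxtaposition.

End Diagrams.

Section MultiPolar.
Variables (K : fieldType) (delta : K).

(* Formal expressions for morphisms; a morphism of MPB(delta) is a class of
   expressions modulo [mrel]. *)
Inductive tm : word -> word -> Type :=
| Dg s t of diagram s t : tm s t
| Hh a b : tm [:: a; b] [:: a; b]
| Cmp s t u of tm t u & tm s t : tm s u
| Tns s t s' t' of tm s t & tm s' t' : tm (s ++ s') (t ++ t')
| Zer s t : tm s t
| Add s t of tm s t & tm s t : tm s t
| Scl s t of K & tm s t : tm s t.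
Arguments Zer {s t}.

Definition cast_tm s s' t t' (es : s = s') (et : t = t') (f : tm s t) :
    tm s' t' :=
  match es in _ = x, et in _ = y return tm x y with erefl, erefl => f end.

Local Notation "g ∘ f" := (Cmp g f) (at level 40, left associativity).
Local Notation "f ⊗ g" := (Tns f g) (at level 35, right associativity).
Local Notation "f ⊞ g" := (Add f g) (at level 50, left associativity).
Local Notation "k • f" := (Scl k f) (at level 38, right associativity).

Definition Id s : tm s s := Dg (idd s).
Definition Cr s t : tm (s ++ t) (t ++ s) := Dg (crossd s t).
Definition Cup : tm [::] [:: Lv; Lv] := Dg cupd.
Definition Cap : tm [:: Lv; Lv] [::] := Dg capd.
Definition E : tm [:: Lv; Lv] [:: Lv; Lv] := Cup ∘ Cap.

Definition H12 (a b c : letter) : tm [:: a; b; c] [:: a; b; c] :=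
  Hh a b ⊗ Id [:: c].
Definition H23 (a b c : letter) : tm [:: a; b; c] [:: a; b; c] :=
  Id [:: a] ⊗ Hh b c.
Definition H13 (a b c : letter) : tm [:: a; b; c] [:: a; b; c] :=
  (Id [:: a] ⊗ Cr [:: c] [:: b]) ∘ (Hh a c ⊗ Id [:: b])
    ∘ (Id [:: a] ⊗ Cr [:: b] [:: c]).

(* The relation presents the free strict monoidal linear category on all diagrams
   and the [Hh a b], modulo the structure constants of the diagram category
   ([mstack], [mjuxt]) and the relations [mH_*]. Casts make the associativity
   and unit laws of words explicit. *)
Reserved Notation "f ≈ g" (at level 70).

Inductive mrel : forall s t, tm s t -> tm s t -> Prop :=
| mrefl s t (f : tm s t) : f ≈ f
| msym s t (f g : tm s t) : f ≈ g -> g ≈ f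
| mtrans s t (f g h : tm s t) : f ≈ g -> g ≈ h -> f ≈ h
| mcmp s t u (g g' : tm t u) (f f' : tm s t) :
    g ≈ g' -> f ≈ f' -> g ∘ f ≈ g' ∘ f'
| mtns s t s' t' (f g : tm s t) (f' g' : tm s' t') :
    f ≈ g -> f' ≈ g' -> f ⊗ f' ≈ g ⊗ g'
| madd s t (f f' g g' : tm s t) : f ≈ f' -> g ≈ g' -> f ⊞ g ≈ f' ⊞ g'
| mscl s t k (f f' : tm s t) : f ≈ f' -> k • f ≈ k • f'
| maddA s t (f g h : tm s t) : f ⊞ (g ⊞ h) ≈ f ⊞ g ⊞ h
| maddC s t (f g : tm s t) : f ⊞ g ≈ g ⊞ f
| madd0 s t (f : tm s t) : Zer ⊞ f ≈ f
| msclA s t k l (f : tm s t) : k • l • f ≈ (k * l) • f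
| mscl1 s t (f : tm s t) : 1 • f ≈ f
| msclDr s t k (f g : tm s t) : k • (f ⊞ g) ≈ k • f ⊞ k • g
| msclDl s t k l (f : tm s t) : (k + l) • f ≈ k • f ⊞ l • f
| mscl0 s t (f : tm s t) : 0 • f ≈ Zer
| mcmpA s t u r (h : tm u r) (g : tm t u) (f : tm s t) :
    h ∘ (g ∘ f) ≈ h ∘ g ∘ f
| mcmp1l s t (f : tm s t) : Id t ∘ f ≈ f
| mcmp1r s t (f : tm s t) : f ∘ Id s ≈ f
| mcmpDr s t u (g : tm t u) (f f' : tm s t) :
    g ∘ (f ⊞ f') ≈ g ∘ f ⊞ g ∘ f'
| mcmpDl s t u (g g' : tm t u) (f : tm s t) :
    (g ⊞ g') ∘ f ≈ g ∘ f ⊞ g' ∘ f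
| mcmpZr s t u k (g : tm t u) (f : tm s t) : g ∘ (k • f) ≈ k • (g ∘ f)
| mcmpZl s t u k (g : tm t u) (f : tm s t) : (k • g) ∘ f ≈ k • (g ∘ f)
| mtnsDr s t s' t' (f : tm s t) (g g' : tm s' t') :
    f ⊗ (g ⊞ g') ≈ f ⊗ g ⊞ f ⊗ g'
| mtnsDl s t s' t' (f f' : tm s t) (g : tm s' t') :
    (f ⊞ f') ⊗ g ≈ f ⊗ g ⊞ f' ⊗ g
| mtnsZr s t s' t' k (f : tm s t) (g : tm s' t') :
    f ⊗ (k • g) ≈ k • (f ⊗ g)
| mtnsZl s t s' t' k (f : tm s t) (g : tm s' t') :
    (k • f) ⊗ g ≈ k • (f ⊗ g)
| mtns1 s t : Id s ⊗ Id t ≈ Id (s ++ t)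
| mtns_cmp s t u s' t' u' (g : tm t u) (f : tm s t) (g' : tm t' u')
    (f' : tm s' t') : (g ⊗ g') ∘ (f ⊗ f') ≈ (g ∘ f) ⊗ (g' ∘ f')
| mtnsA s t s' t' s'' t'' (f : tm s t) (g : tm s' t') (h : tm s'' t'') :
    cast_tm (catA s s' s'') (catA t t' t'') (f ⊗ (g ⊗ h)) ≈ (f ⊗ g) ⊗ h
| mtns_idl s t (f : tm s t) : Id [::] ⊗ f ≈ f
| mtns_idr s t (f : tm s t) : cast_tm (cats0 s) (cats0 t) (f ⊗ Id [::]) ≈ f
| mstack s t u (e : diagram t u) (d : diagram s t) (c : diagram s u) :
    is_stack d e c -> Dg e ∘ Dg d ≈ delta ^+ loops d e • Dg c
| mjuxt s t s' t' (d : diagram s t) (d' : diagram s' t')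
    (c : diagram (s ++ s') (t ++ t')) :
    is_juxt d d' c -> Dg d ⊗ Dg d' ≈ Dg c
| mH_natr w a b :
    Cr w [:: a; b] ∘ (Id w ⊗ Hh a b) ≈ (Hh a b ⊗ Id w) ∘ Cr w [:: a; b]
| mH_natl w a b :
    Cr [:: a; b] w ∘ (Hh a b ⊗ Id w) ≈ (Id w ⊗ Hh a b) ∘ Cr [:: a; b] w
| mH_sym a b :
    Cr [:: b] [:: a] ∘ Hh b a ≈ Hh a b ∘ Cr [:: b] [:: a]
| mH_skewl a :
    (Id [:: Lv] ⊗ Cap ⊗ Id [:: a]) ∘ (Cr [:: Lv] [:: Lv] ⊗ Hh Lv a)
      ∘ (Id [:: Lv] ⊗ Cup ⊗ Id [:: a]) ≈ (-1) • Hh Lv a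
| mH_skewr a :
    (Id [:: a] ⊗ Cap ⊗ Id [:: Lv]) ∘ (Hh a Lv ⊗ Cr [:: Lv] [:: Lv])
      ∘ (Id [:: a] ⊗ Cup ⊗ Id [:: Lv]) ≈ (-1) • Hh a Lv
| mH_4Tl a b c :
    H12 a b c ∘ (H13 a b c ⊞ H23 a b c) ≈ (H13 a b c ⊞ H23 a b c) ∘ H12 a b c
| mH_4Tr a b c :
    (H12 a b c ⊞ H13 a b c) ∘ H23 a b c ≈ H23 a b c ∘ (H12 a b c ⊞ H13 a b c)
| mH_vv : Hh Lv Lv ≈ Cr [:: Lv] [:: Lv] ⊞ (-1) • E
where "f ≈ g" := (mrel f g).

Definition mpb_hom (s t : word) : premod K := @Premod K (tm s t) (@mrel s t)
  (@Zer s t) (@Add s t) (@Scl s t)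
  (@mrefl s t) (@msym s t) (fun g f h => @mtrans s t f g h)
  (@madd s t) (@mscl s t)
  (@maddA s t) (@maddC s t) (@madd0 s t) (@msclA s t) (@mscl1 s t)
  (@msclDr s t) (@msclDl s t) (@mscl0 s t).

Definition MPB_hom (s t : word) : lmodType K := quo (mpb_hom s t).
Definition mor s t (f : tm s t) : MPB_hom s t := @cls _ (mpb_hom s t) f.
Definition expr s t (f : MPB_hom s t) : tm s t := @rep _ (mpb_hom s t) f.

Definition mcomp s t u (g : MPB_hom t u) (f : MPB_hom s t) : MPB_hom s u :=
  mor (expr g ∘ expr f).
Definition mtens s t s' t' (f : MPB_hom s t) (g : MPB_hom s' t') :
  MPB_hom (s ++ s') (t ++ t') := mor (expr f ⊗ expr g).

Lemma morP s t (f g : tm s t) : mor f = mor g <-> f ≈ g.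
Proof. exact: clsP. Qed.
Lemma exprK s t (f : MPB_hom s t) : mor (expr f) = f.
Proof. exact: repK. Qed.
Lemma expr_mor s t (f : tm s t) : expr (mor f) ≈ f.
Proof. exact: (@rep_cls _ (mpb_hom s t)). Qed.

Lemma mor_cmp s t u (g : tm t u) (f : tm s t) :
  mor (g ∘ f) = mcomp (mor g) (mor f).
Proof. by apply/morP/mcmp; apply/msym/expr_mor. Qed.
Lemma mor_tns s t s' t' (f : tm s t) (g : tm s' t') :
  mor (f ⊗ g) = mtens (mor f) (mor g).
Proof. by apply/morP/mtns; apply/msym/expr_mor. Qed.
Lemma morD s t (f g : tm s t) : mor (f ⊞ g) = mor f + mor g.
Proof. exact: (@clsD _ (mpb_hom s t)). Qed.
Lemma morZ s t k (f : tm s t) : mor (k • f) = k *: mor f.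
Proof. exact: (@clsZ _ (mpb_hom s t)). Qed.

Lemma mcompA s t u r (h : MPB_hom u r) (g : MPB_hom t u) (f : MPB_hom s t) :
  mcomp h (mcomp g f) = mcomp (mcomp h g) f.
Proof.
rewrite -(exprK h) -(exprK g) -(exprK f) -!mor_cmp.
exact/morP/mcmpA.
Qed.
Lemma mcomp1m s t (f : MPB_hom s t) : mcomp (mor (Id t)) f = f.
Proof. by rewrite -(exprK f) -mor_cmp; exact/morP/mcmp1l. Qed.
Lemma mcompm1 s t (f : MPB_hom s t) : mcomp f (mor (Id s)) = f.
Proof. by rewrite -(exprK f) -mor_cmp; exact/morP/mcmp1r. Qed.
Lemma mcomp_linr s t u (g : MPB_hom t u) : linear (@mcomp s t u g).
Proof.
move=> k f f'; rewrite -(exprK g) -(exprK f) -(exprK f').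
rewrite -morZ -morD -!mor_cmp -morZ -morD; apply/morP.
by apply: (mtrans (mcmpDr _ _ _)); apply: madd (mcmpZr _ _ _) (mrefl _).
Qed.
Lemma mcomp_linl s t u (f : MPB_hom s t) :
  linear (fun g : MPB_hom t u => mcomp g f).
Proof.
move=> k g g'; rewrite -(exprK g) -(exprK f) -(exprK g').
rewrite -morZ -morD -!mor_cmp -morZ -morD; apply/morP.
by apply: (mtrans (mcmpDl _ _ _)); apply: madd (mcmpZl _ _ _) (mrefl _).
Qed.

Definition MPB : lincat K := @Lincat K word MPB_hom (fun s => mor (Id s)) mcomp
  mcompA mcomp1m mcompm1 mcomp_linr mcomp_linl.

(* [delta] is meant to be nonzero here. *)
Definition Theta : MPB_hom [:: Lv; Lv] [:: Lv; Lv] :=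
  mor (Cr [:: Lv] [:: Lv]) + mor (Id [:: Lv] ⊗ Id [:: Lv])
  - (2 / delta) *: mor E.

Inductive tideal : forall s t, MPB_hom s t -> Prop :=
| tideal_gen : tideal Theta
| tideal0 s t : @tideal s t 0
| tidealD s t (f g : MPB_hom s t) : tideal f -> tideal g -> tideal (f + g)
| tidealZ s t k (f : MPB_hom s t) : tideal f -> tideal (k *: f)
| tideal_compl s t u (g : MPB_hom t u) (f : MPB_hom s t) :
    tideal f -> tideal (mcomp g f)
| tideal_compr s t u (g : MPB_hom t u) (f : MPB_hom s t) :
    tideal g -> tideal (mcomp g f)
| tideal_tensl s t s' t' (f : MPB_hom s t) (g : MPB_hom s' t') :
    tideal g -> tideal (mtens f g)
| tideal_tensr s t s' t' (f : MPB_hom s t) (g : MPB_hom s' t') :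
    tideal f -> tideal (mtens f g).

Definition tl_eq s t (f g : MPB_hom s t) : Prop := tideal (f - g).

Lemma tl_refl s t (f : MPB_hom s t) : tl_eq f f.
Proof. by rewrite /tl_eq subrr; exact: tideal0. Qed.
Lemma tl_eq_of s t (f g : MPB_hom s t) : f = g -> tl_eq f g.
Proof. by move=> ->; exact: tl_refl. Qed.
Lemma tl_sym s t (f g : MPB_hom s t) : tl_eq f g -> tl_eq g f.
Proof. by rewrite /tl_eq -[g - f]opprB -scaleN1r => /(tidealZ (-1)). Qed.
Lemma tl_trans s t (g f h : MPB_hom s t) : tl_eq f g -> tl_eq g h -> tl_eq f h.
Proof.
by move=> fg gh; have := tidealD fg gh; rewrite addrA subrK.
Qed.
Lemma tl_add s t (f f' g g' : MPB_hom s t) :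
  tl_eq f f' -> tl_eq g g' -> tl_eq (f + g) (f' + g').
Proof.
by move=> ff gg; have := tidealD ff gg; rewrite addrACA -opprD.
Qed.
Lemma tl_scale s t k (f f' : MPB_hom s t) :
  tl_eq f f' -> tl_eq (k *: f) (k *: f').
Proof. by move=> /(tidealZ k); rewrite scalerBr. Qed.

Lemma tl_comp s t u (g g' : MPB_hom t u) (f f' : MPB_hom s t) :
  tl_eq g g' -> tl_eq f f' -> tl_eq (mcomp g f) (mcomp g' f').
Proof.
move=> gg ff; apply: (@tl_trans _ _ (mcomp g' f)); rewrite /tl_eq.
- have := tideal_compr f gg.
  by rewrite -scaleN1r addrC mcomp_linl scaleN1r addrC.
- have := tideal_compl g' ff.
  by rewrite -scaleN1r addrC mcomp_linr scaleN1r addrC.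
Qed.

Program Definition tl_premod (s t : word) : premod K :=
  @Premod K (MPB_hom s t) (@tl_eq s t) 0 +%R *:%R
    (@tl_refl s t) (@tl_sym s t) (@tl_trans s t) (@tl_add s t) (@tl_scale s t)
    _ _ _ _ _ _ _ _.
Next Obligation. by apply: tl_eq_of; rewrite addrA. Qed.
Next Obligation. by apply: tl_eq_of; rewrite addrC. Qed.
Next Obligation. by apply: tl_eq_of; rewrite add0r. Qed.
Next Obligation. by apply: tl_eq_of; rewrite scalerA. Qed.
Next Obligation. by apply: tl_eq_of; rewrite scale1r. Qed.
Next Obligation. by apply: tl_eq_of; rewrite scalerDr. Qed.
Next Obligation. by apply: tl_eq_of; rewrite scalerDl. Qed.
Next Obligation. by apply: tl_eq_of; rewrite scale0r. Qed.

Definition MTL_hom (s t : word) : lmodType K := quo (tl_premod s t).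
Definition tl_cls s t (f : MPB_hom s t) : MTL_hom s t :=
  @cls _ (tl_premod s t) f.
Definition tl_rep s t (f : MTL_hom s t) : MPB_hom s t :=
  @rep _ (tl_premod s t) f.

Lemma tl_clsP s t (f g : MPB_hom s t) : tl_cls f = tl_cls g <-> tl_eq f g.
Proof. exact: (@clsP _ (tl_premod s t)). Qed.
Lemma tl_repK s t (f : MTL_hom s t) : tl_cls (tl_rep f) = f.
Proof. exact: repK. Qed.
Lemma tl_rep_cls s t (f : MPB_hom s t) : tl_eq (tl_rep (tl_cls f)) f.
Proof. exact: (@rep_cls _ (tl_premod s t)). Qed.
Lemma tl_clsD s t (f g : MPB_hom s t) : tl_cls (f + g) = tl_cls f + tl_cls g.
Proof. exact: (@clsD _ (tl_premod s t)). Qed.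
Lemma tl_clsZ s t k (f : MPB_hom s t) : tl_cls (k *: f) = k *: tl_cls f.
Proof. exact: (@clsZ _ (tl_premod s t)). Qed.

Definition tl_comp_op s t u (g : MTL_hom t u) (f : MTL_hom s t) :
  MTL_hom s u := tl_cls (mcomp (tl_rep g) (tl_rep f)).

Lemma tl_cls_comp s t u (g : MPB_hom t u) (f : MPB_hom s t) :
  tl_cls (mcomp g f) = tl_comp_op (tl_cls g) (tl_cls f).
Proof. by apply/tl_clsP/tl_comp; apply/tl_sym/tl_rep_cls. Qed.

Program Definition MTL : lincat K := @Lincat K word MTL_hom
  (fun s => tl_cls (mor (Id s))) tl_comp_op _ _ _ _ _.
Next Obligation.
by rewrite -(tl_repK h) -(tl_repK g) -(tl_repK f) -!tl_cls_comp mcompA.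
Qed.
Next Obligation. by rewrite -(tl_repK f) -tl_cls_comp mcomp1m. Qed.
Next Obligation. by rewrite -(tl_repK f) -tl_cls_comp mcompm1. Qed.
Next Obligation.
move=> k f f'; rewrite -(tl_repK g) -(tl_repK f) -(tl_repK f').
by rewrite -tl_clsZ -tl_clsD -!tl_cls_comp -tl_clsZ -tl_clsD mcomp_linr.
Qed.
Next Obligation.
move=> k g g'; rewrite -(tl_repK g) -(tl_repK f) -(tl_repK g').
by rewrite -tl_clsZ -tl_clsD -!tl_cls_comp -tl_clsZ -tl_clsD mcomp_linl.
Qed.

Definition MTL_quot : @functor_on K MPB MTL id :=
  @FunctorOn K MPB MTL id (fun s t f => tl_cls f) (fun s => erefl)
    (fun s t u g f => tl_cls_comp g f).

Definition pole (r : nat) : word := Lm :: nseq r Lv.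
Definition PB : lincat K := @full_sub K MPB nat pole.
Definition PTL : lincat K := @full_sub K MTL nat pole.
Definition PTL_quot : functor PB PTL := restrict MTL_quot pole.

End MultiPolar.

Section Representation.
Variables (K : fieldType) (M : smod K).

Definition lmod (a : letter) : smod K := if a is Lm then M else smodV K.

(* The module of a word: the tensor product of its letters, ending with the
   unit, so that e.g. (m, v) gives M ⊗ (V ⊗ C). *)
Definition wmod (w : word) : smod K :=
  foldr (fun a N => smod_tensor (lmod a) N) (smod_unit K) w.

(* The canonical identification of wmod s ⊗ wmod t with wmod (s ++ t), as a
   bilinear map. *)
Fixpoint wcat (s t : word) : wmod s -> wmod t -> wmod (s ++ t) :=
  match s with
  | [::] => fun (k : K^o) y => (k : K) *: y
  | a :: s' => fun x y => tlift (fun u z => pure u (@wcat s' t z y)) x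
  end.

Definition pure2 (a b : letter) (x : lmod a) (y : lmod b) : wmod [:: a; b] :=
  pure x (pure y (1 : K^o)).

(* The object [r] is M ⊗ V^{⊗ r}. *)
Definition TM : lincat K := @full_sub K (smod_cat K) nat (fun r => wmod (pole r)).

(* The monoidal functors from MPB(-2) to super sp_2-modules with the prescribed
   values on objects and generators. All morphisms are even, so the tensor
   product of morphisms involves no sign; [rf_H] is the action of
   t = -1/2 sum_{c,d} X^c_d ⊗ X^d_c. *)
Record rep_functor := RepFunctor {
  rf :> @functor_on K (MPB (-2)) (smod_cat K) wmod;
  rf_linear : linear_functor rf;
  rf_tens : forall s t s' t' (f : MPB_hom (-2) s t) (g : MPB_hom (-2) s' t')
      (x : wmod s) (y : wmod s'),
    fmap rf (mtens f g) (wcat x y) = wcat (fmap rf f x) (fmap rf g y);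
  rf_cross : forall a b i j (x : lmod a) (y : lmod b), homog i x -> homog j y ->
    fmap rf (mor (-2) (Cr K [:: a] [:: b])) (pure2 x y)
      = (-1) ^+ (i && j) *: pure2 y x;
  rf_cup : fmap rf (mor (-2) (Cup K)) (1 : K^o)
    = \sum_a pure2 (eup K a : lmod Lv) (elow K a : lmod Lv);
  rf_cap : forall x y : lmod Lv,
    fmap rf (mor (-2) (Cap K)) (pure2 x y) = omega x y;
  rf_H : forall a b (x : lmod a) (y : lmod b),
    fmap rf (mor (-2) (Hh K a b)) (pure2 x y) =
      - (1 / 2) *: \sum_c \sum_d pure2 (sact (Xel K c d) x) (sact (Xel K d c) y)
}.

Definition FM (F : rep_functor) : functor (PB (-2)) TM := restrict F pole.

End Representation.

(* Main.v *)
Require Import Defs.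
From mathcomp Require Import all_boot all_algebra.
From mathcomp Require Import reals complex.
From mathcomp Require Import boolp.

Set Implicit Arguments.
Unset Strict Implicit.
Unset Printing Implicit Defensive.

Import GRing.Theory.
Local Open Scope ring_scope.

(** Everything rests on the fact that the functor sends [Theta] to zero. As [V]
    is purely odd, the crossing of two [v]-strands becomes [- flip], and for
    [delta = -2] the coefficient [- 2 / delta] of [E] is [1], so the image of
    [Theta] is
      [x ⊗ y |-> x ⊗ y - y ⊗ x + omega(x, y) c],
    where [c] is the image of the cup. The map [x ⊗ y - y ⊗ x] is bilinear and
    alternating, and on a two-dimensional space such a map is [omega] times its
    value at the basis [(e^1, e^2)] ([alternating_omega]); this value is [- c]
    ([pure2_flip], [fmap_Theta]).

    The morphisms killed by a linear monoidal functor form a tensor ideal, so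
    the whole ideal generated by [Theta] is killed ([fmap_tideal]). For the
    closure under tensor products one needs that a linear map out of the module
    of a concatenated word is determined by its values on concatenations
    ([wcat_ext]), because [rf_tens] describes [F (f ⊗ g)] only there.

    A linear functor that kills the ideal descends to the quotient category
    ([descend]), and restricting to the words [m v^r] gives the required functor.
    It is unique because the quotient functor is the identity on objects and
    surjective on morphisms ([PTL_quot_epi]). The equality of functors includes
    the equality of their object maps, over which the types of the morphism maps
    depend; [Functor_inj] disposes of this dependency. *)

(** * Tensor products along words *)

Section Words.
Variables (K : fieldType) (M : smod K).

Lemma linZ (U P : lmodType K) (f : U -> P) :
  linear f -> forall k x, f (k *: x) = k *: f x.
Proof. by move=> lf k x; exact: (linearZ_LR (lin_pack lf)). Qed.

Lemma wcat_bilin s t : bilin (@wcat K M s t).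
Proof.
elim: s => [|a s [IHr IHl]] /=.
  split=> [x k y y'|y k x x'] /=; first by rewrite scalerDr !scalerA mulrC.
  by rewrite scalerDl -scalerA.
have bf y : bilin (fun (u : lmod M a) z => pure u (@wcat K M s t z y)).
  exact: bilin_comp (@id_linear _ _) (IHl y).
split=> [x k y y'|y]; last exact: tlift_linear.
move: x; apply: tensor_ext => [||u z]; first exact: tlift_linear.
  by apply: lin_add; [apply: lin_scale|]; exact: tlift_linear.
by rewrite !tlift_pure // IHr; exact: (pure_bilin _ _).1.
Qed.

Lemma wcat_cons a s t (u : lmod M a) z y :
  @wcat K M (a :: s) t (pure u z) y = pure u (wcat z y).
Proof.
exact/tlift_pure/(bilin_comp (@id_linear _ _))/(wcat_bilin s t).2.
Qed.

(** Concatenations span: strip the letters of [s] one at a time, each of them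
    being handled by the spanning property of pure tensors. *)
Lemma wcat_ext s t (P : lmodType K) (f g : wmod M (s ++ t) -> P) :
  linear f -> linear g -> (forall x y, f (wcat x y) = g (wcat x y)) -> f =1 g.
Proof.
elim: s f g => [|a s IH] f g lf lg fg.
  by move=> z; rewrite -[z]scale1r; exact: (fg (1 : K^o) z).
apply: tensor_ext => // u; apply: IH => [||x y].
- by apply: lin_comp lf; exact: (pure_bilin _ _).1.
- by apply: lin_comp lg; exact: (pure_bilin _ _).1.
- by have := fg (pure u x) y; rewrite wcat_cons.
Qed.

Lemma pure2_bilin a b : bilin (@pure2 K M a b).
Proof.
split=> [x k y y'|y k x x'] /=; rewrite /pure2.
  by rewrite (pure_bilin _ _).2 (pure_bilin _ _).1.
exact: (pure_bilin _ _).2.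
Qed.

Lemma pure2_ext a b (P : lmodType K) (f g : wmod M [:: a; b] -> P) :
  linear f -> linear g ->
  (forall (x : lmod M a) (y : lmod M b), f (pure2 x y) = g (pure2 x y)) ->
  f =1 g.
Proof.
move=> lf lg fg; apply: (@tensor_ext K (lmod M a) (wmod M [:: b])) => // x.
have lp := (pure_bilin (lmod M a) (wmod M [:: b])).1 x.
apply: (@tensor_ext K (lmod M b) (smod_unit K)) => [||y k].
- exact: lin_comp lp lf.
- exact: lin_comp lp lg.
(* The module of a word ends with a factor K, whose entry is a scalar to pull
   out. *)
rewrite -[k]mulr1 -[k * 1]/(k *: (1 : K^o)) !pureZr (linZ lf) (linZ lg).
by congr (_ *: _); exact: fg.
Qed.

End Words.

(** * The symplectic plane *)

Section Plane.
Variable K : fieldType.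

Lemma eup_expand (x : 'cV[K]_2) : x = x 0 0 *: eup K 0 + x 1 0 *: eup K 1.
Proof.
apply/colP=> i; rewrite !mxE; case: i => [[|[|//]] h] /=;
  rewrite ?mulr1 ?mulr0 ?addr0 ?add0r; congr (x _ _); exact: val_inj.
Qed.

Lemma omegaE (x y : 'cV[K]_2) : omega x y = x 0 0 * y 1 0 - x 1 0 * y 0 0.
Proof.
rewrite /omega !(mxE, big_ord_recl, big_ord0) /=.
have -> : lift ord0 ord0 = 1 :> 'I_2 by exact: val_inj.
rewrite !(subr0, sub0r, subrr, mulr0, mulr1, mulrN, addr0, add0r, mulNr).
by rewrite addrC.
Qed.

Lemma elow0 : elow K 0 = - eup K 1.
Proof.
apply/colP=> i; rewrite /elow glowE !big_ord_recl big_ord0 !mxE /=.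
by case: i => [[|[|//]] h] /=; rewrite
  !(subr0, sub0r, subrr, mulr0, mulr1, mulrN, addr0, add0r, mulNr, oppr0).
Qed.

Lemma elow1 : elow K 1 = eup K 0.
Proof.
apply/colP=> i; rewrite /elow glowE !big_ord_recl big_ord0 !mxE /=.
by case: i => [[|[|//]] h] /=; rewrite !(subr0, sub0r, subrr, mulr0, mulr1,
  mulrN, addr0, add0r, mulNr, oppr0, opprK).
Qed.

(** The second exterior power of the plane is a line, on which [omega] is the
    coordinate for which the wedge of the basis vectors is [1]. *)
Lemma alternating_omega (P : lmodType K) (f : 'cV[K]_2 -> 'cV[K]_2 -> P) :
  bilin f -> (forall x, f x x = 0) ->
  forall x y, f x y = omega x y *: f (eup K 0) (eup K 1).
Proof.
move=> [fr fl] alt.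
have skew x y : f y x = - f x y.
  apply/eqP; rewrite -addr_eq0 addrC; apply/eqP.
  have := alt (x + y); rewrite (linD (fr _)) !(linD (fl _)) !alt add0r addr0.
  by rewrite addrC.
have fZr x k y : f x (k *: y) = k *: f x y by exact: (linZ (fr x)).
have fZl x k y : f (k *: x) y = k *: f x y by exact: (linZ (fl y)).
move=> x y; rewrite {1}(eup_expand x) {1}(eup_expand y).
rewrite (linD (fr _)) !(linD (fl _)) !fZr !fZl !alt [f (eup K 1) _]skew.
rewrite !scaler0 add0r addr0 !scalerN !scalerA addrC -scalerBl omegaE.
by rewrite mulrC [y 0 0 * _]mulrC.
Qed.

(** The sum over [a] is the image of the cup: it is [e^2 ⊗ e^1 - e^1 ⊗ e^2], the
    opposite of the alternating map on the left at [(e^1, e^2)]. *)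
Lemma pure2_flip (M : smod K) (x y : lmod M Lv) :
  pure2 x y - pure2 y x
    + omega x y *: \sum_a pure2 (eup K a : lmod M Lv) (elow K a : lmod M Lv)
  = 0.
Proof.
have [pr pl] := pure2_bilin M Lv Lv.
have bf : bilin (fun x y : lmod M Lv => pure2 x y - pure2 y x).
  by split=> [u k v v'|u k v v'] /=; rewrite pr pl opprD addrACA -scalerBr.
rewrite (alternating_omega bf) => [|u]; last exact: subrr.
rewrite -scalerDr big_ord_recl big_ord1.
have -> : lift ord0 ord0 = 1 :> 'I_2 by exact: val_inj.
have -> : pure2 (eup K 0 : lmod M Lv) (elow K 0 : lmod M Lv)
          = - pure2 (eup K 0 : lmod M Lv) (eup K 1 : lmod M Lv).
  by rewrite elow0; exact: (linearN (lin_pack (pr (eup K 0)))).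
by rewrite elow1 [X in _ + X]addrC addrA subrK subrr scaler0.
Qed.

End Plane.

(** * The kernel of the functor *)

Section Kernel.
Variables (K : fieldType) (M : smod K) (F : rep_functor M).

Lemma fmapD s t (f g : MPB_hom (-2 : K) s t) x :
  fmap F (f + g) x = fmap F f x + fmap F g x.
Proof. by rewrite (linD (@rf_linear _ _ F s t)). Qed.

Lemma fmapZ s t k (f : MPB_hom (-2 : K) s t) x :
  fmap F (k *: f) x = k *: fmap F f x.
Proof. by rewrite (linZ (@rf_linear _ _ F s t)). Qed.

Lemma fmap_E (x y : lmod M Lv) :
  fmap F (mor (-2) (E K)) (pure2 x y)
    = omega x y *: \sum_a pure2 (eup K a : lmod M Lv) (elow K a : lmod M Lv).
Proof.
rewrite mor_cmp (fmap_comp F (mor (-2) (Cup K)) (mor (-2) (Cap K))) /= rf_cap.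
have [lc _ _] := smod_homP (fmap F (mor (-2) (Cup K))).
have := linZ lc (omega x y) (1 : K^o).
by rewrite [_ *: (1 : K^o)]mulr1 /= rf_cup.
Qed.

Lemma fmap_Theta : (2 : K) != 0 -> fmap F (Theta (-2)) = 0.
Proof.
move=> nz2; apply: smod_hom_ext; apply: pure2_ext => [||x y].
- by case: (smod_homP (fmap F (Theta (-2)))).
- exact: lin_zero.
have -> : Theta (-2) = mor (-2 : K) (Cr K [:: Lv] [:: Lv])
    + mor (-2) (Id K [:: Lv; Lv]) + mor (-2) (E K).
  rewrite /Theta ((morP _ _ _).2 (mtns1 _ _ _)).
  by rewrite invrN mulrN divff // scaleN1r opprK.
(* Both arguments are odd, which gives the crossing its sign. *)
rewrite !fmapD fmap_E (fmap_id F [:: Lv; Lv]).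
rewrite (rf_cross F (i := true) (j := true)) //.
by rewrite expr1 scaleN1r [- _ + _]addrC pure2_flip.
Qed.

Lemma fmap_tideal s t (f : MPB_hom (-2 : K) s t) :
  (2 : K) != 0 -> tideal f -> fmap F f = 0.
Proof.
move=> nz2; elim=> {s t f} [|s t|s t f g _ hf _ hg|s t k f _ hf
  |s t u g f _ hf|s t u g f _ hg|s t s' t' f g _ hg|s t s' t' f g _ hf].
- exact: fmap_Theta.
- exact: lin0 (@rf_linear _ _ F s t).
- by rewrite (linD (@rf_linear _ _ F s t)) hf hg addr0.
- by apply: smod_hom_ext => x; rewrite fmapZ hf; exact: scaler0.
- by rewrite (fmap_comp F g f) hf; exact: (lin0 (comp_linr _)).
- by rewrite (fmap_comp F g f) hg; exact: (lin0 (comp_linl _)).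
- apply: smod_hom_ext; apply: wcat_ext => [||x y].
  + by case: (smod_homP (fmap F (mtens f g))).
  + exact: lin_zero.
  by rewrite rf_tens hg; exact: (lin0 ((wcat_bilin M t t').1 _)).
- apply: smod_hom_ext; apply: wcat_ext => [||x y].
  + by case: (smod_homP (fmap F (mtens f g))).
  + exact: lin_zero.
  by rewrite rf_tens hf; exact: (lin0 ((wcat_bilin M t t').2 _)).
Qed.

End Kernel.

(** * The universal property of the quotient category *)

Section Descent.
Variables (K : fieldType) (delta : K) (D : lincat K) (o : word -> D).
Variable F : @functor_on K (MPB delta) D o.
Hypothesis linF : linear_functor F.
Hypothesis killF :
  forall s t (f : MPB_hom delta s t), tideal f -> fmap F f = 0.

Lemma fmap_tl_rep s t (f : MPB_hom delta s t) :
  fmap F (tl_rep (tl_cls f)) = fmap F f.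
Proof.
have /killF := tl_rep_cls f.
rewrite -[fmap F _]/(lin_pack (linF (x := s) (y := t)) _).
by rewrite linearB => /subr0_eq.
Qed.

Program Definition descend : @functor_on K (MTL delta) D o :=
  @FunctorOn K (MTL delta) D o (fun s t f => fmap F (tl_rep f)) _ _.
Next Obligation. by rewrite fmap_tl_rep; exact: fmap_id. Qed.
Next Obligation. by rewrite fmap_tl_rep; exact: fmap_comp. Qed.

Lemma descend_cls s t (f : MPB_hom delta s t) :
  fmap descend (tl_cls f) = fmap F f.
Proof. exact: fmap_tl_rep. Qed.

Lemma descend_linear : linear_functor descend.
Proof.
move=> s t k f g; rewrite -(tl_repK f) -(tl_repK g) -tl_clsZ -tl_clsD.
by rewrite !descend_cls linF.
Qed.

End Descent.

Section FunctorEquality.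
Variable K : fieldType.

Lemma functor_on_ext (C D : lincat K) (o : C -> D) (F G : functor_on o) :
  (forall x y (f : Defs.hom x y), fmap F f = fmap G f) -> F = G.
Proof.
case: F G => [f f1 f2] [g g1 g2] /= fg.
have {}fg : f = g.
  apply/functional_extensionality_dep => x.
  by apply/functional_extensionality_dep => y; exact/funext.
by case: _ / fg in g1 g2 *; congr FunctorOn; exact: Prop_irrelevance.
Qed.

(** Equal functors have morphism maps that agree after transport along the
    equality of object maps; when both object maps are [o], that equality is
    reflexivity by proof irrelevance. *)
Lemma Functor_inj (C D : lincat K) (o : C -> D) (F G : functor_on o) :
  Functor F = Functor G -> F = G.
Proof.
move=> FG; suff h (P Q : functor C D) (PQ : P = Q) (e : fobj P = fobj Q) :
    ecast o (functor_on o) e (fmor P) = fmor Q.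
  exact: (h _ _ FG (erefl o)).
by case: _ / PQ in e *; rewrite (Prop_irrelevance e erefl).
Qed.

Lemma PTL_quot_epi (delta : K) (D : lincat K) (G G' : functor (PTL delta) D) :
  functor_comp G (PTL_quot delta) = functor_comp G' (PTL_quot delta) -> G = G'.
Proof.
case: G G' => [o G] [o' G'] GG'.
have oo' : o = o' by exact: (congr1 (@fobj _ _ _) GG').
case: _ / oo' in G' GG' *; congr Functor; apply: functor_on_ext => r r' f.
have {}GG' := Functor_inj GG'.
rewrite -(tl_repK f).
exact: (congr1 (fun H => @fmap _ (PB delta) _ _ H r r' (tl_rep f)) GG').
Qed.

End FunctorEquality.

(** * The factorisation *)

Theorem lemma7p1 (R : realType) (M : smod R[i]) (F : rep_functor M) :
  exists G : functor (@PTL (R[i] : fieldType) (-2)) (TM M),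
    [/\ linear_functor G,
        functor_comp G (PTL_quot (-2)) = FM F
      & forall G' : functor (@PTL (R[i] : fieldType) (-2)) (TM M),
          functor_comp G' (PTL_quot (-2)) = FM F -> G' = G].
Proof.
have nz2 : (2 : R[i]) != 0 by rewrite Num.Theory.pnatr_eq0.
have kill s t (f : MPB_hom (-2) s t) (fI : tideal f) := fmap_tideal F nz2 fI.
have linF := @rf_linear _ _ F.
pose G : functor (@PTL (R[i] : fieldType) (-2)) (TM M) :=
  Defs.restrict (descend linF kill) pole.
have GF : functor_comp G (PTL_quot (-2)) = FM F.
  congr Functor; apply: functor_on_ext => r r' f.
  exact: (descend_cls linF kill (f : MPB_hom _ (pole r) (pole r'))).
exists G; split=> // [r r'|G' G'F].
  exact: (@descend_linear _ _ _ _ _ linF kill (pole r) (pole r')).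
by apply: PTL_quot_epi; rewrite GF.
Qed.
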